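(* For every integer $r\ge 3$, the graph $h^r$ is ELC-preserved and corresponds to the $[2^r-1,\,2^r-r-1,\,3]$ Hamming code.
   Context: All graphs are finite, simple and undirected. For a graph $G=(V,E)$ and $v\in V$, $N_v$ is the set of vertices adjacent to $v$. Local complementation (LC) on $v$ transforms $G$ into $G*v$ by replacing the induced subgraph of $G$ on $N_v$ by its complement. For an edge $\{u,v\}\in E$, edge local complementation (ELC) on $\{u,v\}$ transforms $G$ into $G^{(u,v)}=G*u*v*u=G*v*u*v$ (operations applied from left to right). $G$ is ELC-preserved if for every edge $\{u,v\}\in E$, $G^{(u,v)}$ is isomorphic to $G$. The graph $h^r$ is the bipartite graph on $2^r-1$ vertices with partitions $U$, of size $r$, and $W$, of size $2^r-r-1$, where $W$ is the disjoint union of sets $W_i$, $2\le i\le r$, with $|W_i|=\binom{r}{i}$; each vertex in $W_i$ is adjacent to exactly $i$ vertices of $U$, and $N_a\ne N_b$ for all distinct $a,b\in W$. An $[n,k,d]$ code is a $k$-dimensional subspace of $\mathbb{F}_2^n$ with minimum distance $d$; two codes are equivalent if one is obtained from the other by a permutation of coordinates. A bipartite graph corresponds to an $[n,k]$ code $\mathcal{C}$ if it is isomorphic to the $(k,n-k)$-bipartite graph with adjacency matrix $\begin{pmatrix}\mathbf{0}_{k\times k}&P\\P^{\mathrm T}&\mathbf{0}_{(n-k)\times(n-k)}\end{pmatrix}$ for some generator matrix $(I\mid P)$ of a code equivalent to $\mathcal{C}$. (Up to isomorphism, the same graph then also corresponds to the dual code $\mathcal{C}^\perp$, generated up to equivalence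 by $(P^{\mathrm T}\mid I)$.) *)

(* Defs.v *)
From mathcomp Require Import all_boot all_order all_fingroup all_algebra.
From mathcomp Require Import zify.

Set Implicit Arguments.
Unset Strict Implicit.
Unset Printing Implicit Defensive.

Import GRing.Theory.

Section Graphs.

Variable T : finType.
Implicit Types (e : rel T) (u v : T).

Definition simple_graph e := symmetric e /\ irreflexive e.

Definition nbh e v : {set T} := [set u | e v u].

Definition lc e v : rel T :=
  fun x y => if [&& x != y, x \in nbh e v & y \in nbh e v]
             then ~~ e x y else e x y.

Definition elc e u v : rel T := lc (lc (lc e u) v) u.

Lemma elcC e u v : simple_graph e -> e u v -> elc e u v =2 elc e v u.
Proof.
move=> [es ei] euv x y; have evu : e v u by rewrite es.
have nuv : (u == v) = false by apply: contraTF euv => /eqP->; rewrite ei.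
have nvu : (v == u) = false by rewrite eq_sym.
rewrite /elc /lc !inE.
have [->|/negPf xu] := eqVneq x u; last have [->|/negPf xv] := eqVneq x v;
  (have [->|/negPf yu] := eqVneq y u; last have [->|/negPf yv] := eqVneq y v);
  rewrite ?(eq_sym u x) ?(eq_sym v x) ?(eq_sym u y) ?(eq_sym v y)
    ?eqxx ?nuv ?nvu ?xu ?xv ?yu ?yv ?ei ?euv ?evu //=;
  rewrite ?(es x u) ?(es x v) ?(es y u) ?(es y v);
  repeat match goal with
  | |- context [e ?a ?b] => case: (e a b) => /=
  | |- context [x == y] => case: (x == y) => /=
  end => //.
Qed.

End Graphs.

Definition isomorphic (T1 T2 : finType) (e1 : rel T1) (e2 : rel T2) :=
  exists2 f : T1 -> T2, bijective f & {mono f : x y / e1 x y >-> e2 x y}.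

Definition elc_preserved (T : finType) (e : rel T) :=
  forall u v, e u v -> isomorphic (elc e u v) e.

Definition bipartition (T : finType) (e : rel T) (U W : {set T}) :=
  [/\ U :|: W = [set: T], [disjoint U & W],
      {in U &, forall x y, ~~ e x y} & {in W &, forall x y, ~~ e x y}].

(* The description determines the graph up to isomorphism, so h^r is rendered
   as the class of all graphs that satisfy it; is_h_exists shows that the class
   is inhabited. *)
Definition is_h (r : nat) (T : finType) (e : rel T) :=
  [/\ simple_graph e, #|T| = 2 ^ r - 1 &
      exists (U W : {set T}) (Wi : nat -> {set T}),
        [/\ bipartition e U W, #|U| = r, #|W| = 2 ^ r - r - 1,
            W = \bigcup_(2 <= i < r.+1) Wi i &
            [/\ forall i j, 2 <= i <= r -> 2 <= j <= r -> i != j ->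
                  [disjoint Wi i & Wi j],
                forall i, 2 <= i <= r -> #|Wi i| = 'C(r, i),
                forall i a, 2 <= i <= r -> a \in Wi i ->
                  #|nbh e a :&: U| = i &
                {in W &, forall a b, a != b -> nbh e a != nbh e b}]]].

Lemma is_h_exists r : exists (T : finType) (e : rel T), is_h r e.
Proof.
pose S : finType := {A : {set 'I_r} | 2 <= #|A|}.
pose T : finType := ('I_r + S)%type.
pose e : rel T := fun x y => match x, y with
  | inl i, inr A => i \in val A | inr A, inl i => i \in val A
  | _, _ => false end.
pose U : {set T} := [set x : T | if x is inl _ then true else false].
pose Wi (k : nat) : {set T} := [set x : T | if x is inr A then #|val A| == k else false].
have cS : #|S| + r + 1 = 2 ^ r.
  rewrite card_sig -[in RHS](card_ord r) -cardsT -card_powerset.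
  pose D (k : nat) := [set A : {set 'I_r} | #|A| == k].
  have D0 : #|D 0| = 1 by rewrite card_draws bin0.
  have D1 : #|D 1| = r by rewrite card_draws card_ord bin1.
  rewrite -[X in _ + X + _]D1 -[X in _ + X]D0.
  rewrite powersetT cardsT -[RHS](cardC [pred A : {set 'I_r} | 2 <= #|A|]) -addnA.
  congr addn; rewrite -cardsUI.
  have -> : D 1 :&: D 0 = set0.
    by apply/setP => A; rewrite !inE; case: #|A| => [|[]].
  rewrite cards0 addn0; apply: eq_card => A; rewrite !inE.
  by case: #|A| => [|[]].
have cW k : #|Wi k| = if 2 <= k then 'C(r, k) else 0.
  case: ifP => k2; last first.
    apply/eqP; rewrite cards_eq0; apply/eqP/setP => -[i|A]; rewrite !inE //.
    by apply: contraFF k2 => /eqP<-; apply: (valP A).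
  rewrite -[in RHS](card_ord r) -card_draws.
  pose g (x : T) : {set 'I_r} := if x is inr A then val A else set0.
  have gi : {in Wi k &, injective g}.
    move=> [i|A] [j|B]; rewrite !inE //= => _ _ /val_inj -> //.
  rewrite -(card_in_imset gi); apply: eq_card => A; rewrite !inE.
  apply/imsetP/idP => [[x + ->]|Ak]; first by case: x => [i|B]; rewrite inE.
  have A2 : 2 <= #|A| by rewrite (eqP Ak).
  by exists (inr (exist _ A A2)); rewrite ?inE.
have cU : #|U| = r.
  have -> : U = [set inl i | i : 'I_r].
    apply/setP => -[i|A]; rewrite !inE; apply/esym; first exact: imset_f.
    by apply/negbTE/imsetP => -[].
  by rewrite card_imset ?card_ord // => ? ? [].
have nW (A : S) : nbh e (inr A) = [set inl i | i in val A].
  apply/setP => -[i|B]; rewrite !inE /=.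
    by rewrite mem_imset // => ? ? [].
  by apply/esym/negbTE/imsetP => -[].
exists T, e; split.
- by split=> [[i|A] [j|B]|[i|A]].
- by rewrite card_sum card_ord; lia.
exists U, (~: U), Wi; split=> //.
- split; rewrite ?setUCr -?setI_eq0 ?setICr //.
  + by move=> [i|A] [j|B]; rewrite !inE.
  + by move=> [i|A] [j|B]; rewrite !inE.
- by rewrite cardsCs setCK cU card_sum card_ord; lia.
- apply/setP => x; rewrite big_geq_mkord; apply/idP/bigcupP.
    case: x => [i|A]; rewrite !inE // => _.
    have Ar : #|val A| < r.+1 by rewrite ltnS -[X in _ <= X]card_ord max_card.
    by exists (Ordinal Ar); rewrite ?inE //=; apply: (valP A).
  by case=> i _; case: x => [j|A]; rewrite !inE.
split.
- move=> i j _ _ ij; rewrite -setI_eq0; apply/eqP/setP => -[k|A]; rewrite !inE //.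
  by apply: contraNF ij => /andP[/eqP<- /eqP<-].
- by move=> i /andP[i2 _]; rewrite cW i2.
- move=> i [j|A] _; rewrite inE // => /eqP <-.
  rewrite nW (setIidPl _) ?card_imset // => [? ? []//|].
  by apply/subsetP => _ /imsetP[j _ ->]; rewrite inE.
move=> [i|A] [j|B]; rewrite !inE // => _ _.
apply: contraNN; rewrite !nW => /eqP AB; apply/eqP; congr inr; apply: val_inj.
by apply: (imset_inj _ AB) => ? ? [].
Qed.

Section Codes.

Variable n : nat.

Definition code := {vspace 'rV['F_2]_n}.

Definition hdist (x y : 'rV['F_2]_n) : nat :=
  #|[set i | x ord0 i != y ord0 i]|.

Definition min_distance (C : code) (d : nat) :=
  (exists x y, [/\ x \in C, y \in C, x != y & hdist x y = d]) /\
  {in C &, forall x y, x != y -> d <= hdist x y}.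

Definition code_params (C : code) (k d : nat) :=
  \dim C = k /\ min_distance C d.

Definition code_equiv (C C' : code) :=
  exists s : 'S_n, forall x, (x \in C') = (col_perm s x \in C).

Definition generator_matrix (k : nat) (C : code) (M : 'M['F_2]_(k, n)) :=
  basis_of C [tuple row i M | i < k].

End Codes.

(* The columns of the parity-check matrix are the nonzero vectors of F_2^r,
   each occurring exactly once. *)
Definition is_hamming (r : nat) (C : code (2 ^ r - 1)) :=
  exists H : 'M['F_2]_(r, 2 ^ r - 1),
    perm_eq (codom (fun j => col j H)) (enum [pred x : 'cV['F_2]_r | x != 0%R])
    /\ forall x, (x \in C) = (H *m x^T == 0)%R.

Arguments is_hamming r C : clear implicits.

Lemma is_hamming_exists r : exists C : code (2 ^ r - 1), is_hamming r C.
Proof.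
pose N := [pred x : 'cV['F_2]_r | x != 0%R].
have cN : 2 ^ r - 1 = #|N|.
  have := cardC1 (0%R : 'cV['F_2]_r).
  rewrite card_mx card_Fp // muln1 subn1 => <-.
  by apply: eq_card => x; rewrite !inE.
pose c j : 'cV['F_2]_r := enum_val (cast_ord cN j).
pose H : 'M['F_2]_(r, 2 ^ r - 1) := (\matrix_(i, j) c j i ord0)%R.
have Hc j : col j H = c j.
  by apply/colP => i; rewrite mxE [H _ _]mxE.
pose f : 'Hom('rV['F_2]_(2 ^ r - 1), 'rV['F_2]_r) := linfun (mulmxr H^T%R).
exists (lker f), H; split=> [|x]; last first.
  by rewrite memv_ker lfunE /= -(inj_eq trmx_inj) trmx_mul trmxK trmx0.
apply: uniq_perm; rewrite ?enum_uniq //.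
  apply/injectiveP => i j; rewrite !Hc => /enum_val_inj; exact: cast_ord_inj.
move=> x; rewrite mem_enum; apply/codomP/idP => [[j ->]|xN].
  by rewrite Hc; apply: enum_valP.
exists (cast_ord (esym cN) (enum_rank_in xN x)).
by rewrite Hc /c cast_ordKV enum_rankK_in.
Qed.

Definition graph_of_adjmx (n : nat) (A : 'M['F_2]_n) : rel 'I_n :=
  fun i j => A i j == 1%R.

(* The cast identifies 'I_(k + m) with 'I_n; being the number of rows of a
   generator matrix, k is necessarily the dimension of C. *)
Definition corresponds (T : finType) (e : rel T) (n : nat) (C : code n) :=
  exists (k m : nat) (nE : k + m = n) (P : 'M['F_2]_(k, m)) (C' : code n),
    [/\ code_equiv C C',
        generator_matrix C' (castmx (erefl k, nE) (row_mx 1%:M P)%R) &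
        isomorphic e (graph_of_adjmx (block_mx 0 P P^T 0)%R)].

(* Main.v *)
Require Import Defs.
From mathcomp Require Import all_boot all_order all_fingroup all_algebra.

(** Label the vertices of h^r by the nonempty subsets of U: a vertex of U gets
    its singleton, a vertex outside U its neighbourhood.  Counting shows that
    this is a bijection ([label_inj], [label_onto]), so the vertices are the
    nonzero vectors of F_2^U, with U as a basis, and x in U is adjacent to y
    outside U exactly when x occurs in the expansion of y in that basis.

    ELC on an edge uw with u in U exchanges the basis U for the basis U - u + w:
    the new graph records the same vectors expanded in the new basis.  All
    nonzero vectors are still there, so the linear map that sends the new basis
    to the old one (w to u, the rest of U fixed) is a permutation of the
    vertices; it is the isomorphism of [elc_iso].

    For the code, let P be the biadjacency matrix of the graph, with rows indexed
    by the complement of U.  The columns of (P^T | I) are the labels, that is,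
    all nonzero vectors, so (P^T | I) is a parity-check matrix of the Hamming
    code up to a permutation of the coordinates, while (I | P) generates its
    kernel; this gives the correspondence and the dimension
    ([corresponds_hamming]).  The minimum distance is 3 because the columns of a
    parity-check matrix are nonzero and distinct, and because a, b, a + b is a
    dependent triple of columns. *)

Set Implicit Arguments.
Unset Strict Implicit.
Unset Printing Implicit Defensive.

Import GRing.Theory.

(** * Edge local complementation as a pivot *)

Section EdgeLocalComplementation.

Variables (T : finType) (e : rel T).
Hypothesis simple_e : simple_graph e.

(** The pivot formula: away from the edge, the pairs that are toggled are those
    joining a neighbour of one end to a neighbour of the other, and the two ends
    exchange their neighbourhoods.  Every case is a Boolean identity between the
    adjacencies of u, v, x and y. *)
Lemma elc_tperm u v x y : e u v ->
  elc e u v x y = e (tperm u v x) (tperm u v y) (+)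
    [&& x != y, x \notin [set u; v], y \notin [set u; v] &
        (e u x && e v y) (+) (e v x && e u y)].
Proof.
have [es ei] := simple_e.
move=> euv; have evu : e v u by rewrite es.
have nuv : (u == v) = false by apply: contraTF euv => /eqP->; rewrite ei.
have nvu : (v == u) = false by rewrite eq_sym.
rewrite /elc /lc !inE.
case: tpermP => [->|->|/eqP/negPf xu /eqP/negPf xv];
  case: tpermP => [->|->|/eqP/negPf yu /eqP/negPf yv];
  rewrite ?(eq_sym u x) ?(eq_sym v x) ?(eq_sym u y) ?(eq_sym v y)
    ?eqxx ?nuv ?nvu ?xu ?xv ?yu ?yv ?ei ?euv ?evu //=;
  rewrite ?(es x u) ?(es x v) ?(es y u) ?(es y v);
  repeat match goal with
  | |- context [e ?a ?b] => case: (e a b) => /=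
  | |- context [x == y] => case: (x == y) => /=
  end => //.
Qed.

End EdgeLocalComplementation.

(** * The vertices of h^r as the nonempty subsets of U *)

Section Labels.

Variables (T : finType) (e : rel T) (U : {set T}).

(** Together with #|T| = 2 ^ #|U| - 1 this determines the graph: neighbourhoods
    outside U are distinct subsets of U of size at least 2, and there are just
    enough vertices to realise all of them. *)
Definition h_structure :=
  [/\ {in U &, forall x y, ~~ e x y}, {in ~: U &, forall x y, ~~ e x y},
      {in ~: U, forall a, 2 <= #|nbh e a|} & {in ~: U &, injective (nbh e)}].

Definition label x : {set T} := if x \in U then [set x] else nbh e x.

Hypotheses (simple_e : simple_graph e) (h_e : h_structure)
  (cardT : #|T| = 2 ^ #|U| - 1).

Lemma adj_label x y : y \notin U -> e x y = (x \in label y).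
Proof.
by move=> yU; have [es _] := simple_e; rewrite /label (negPf yU) inE es.
Qed.

Lemma label_sub x : label x \subset U.
Proof.
have [_ eW _ _] := h_e; rewrite /label.
case: ifPn => xU; first by rewrite sub1set.
apply/subsetP => y; rewrite inE; apply: contraTT => yU.
by apply: eW; rewrite inE.
Qed.

Lemma label_neq0 x : label x != set0.
Proof.
have [_ _ e2 _] := h_e; rewrite /label -card_gt0.
by case: ifPn => xU; rewrite ?cards1 // ltnW // e2 ?inE.
Qed.

Lemma label_inj : injective label.
Proof.
have [_ _ e2 eI] := h_e.
have mixed x y : x \in U -> y \notin U -> label x != label y.
  move=> xU yU; rewrite /label xU (negPf yU); apply/eqP => xy.
  by have := e2 y; rewrite -xy cards1 inE yU => /(_ isT).
move=> x y; have [xU|xU] := boolP (x \in U); have [yU|yU] := boolP (y \in U).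
- by rewrite /label xU yU => /set1_inj.
- by move=> xy; have := mixed _ _ xU yU; rewrite xy eqxx.
- by move=> xy; have := mixed _ _ yU xU; rewrite xy eqxx.
- by rewrite /label (negPf xU) (negPf yU) => /eI ->; rewrite ?inE.
Qed.

(** An injection into the nonempty subsets of U from a set of the same size. *)
Lemma label_onto (A : {set T}) :
  A \subset U -> A != set0 -> exists x, label x = A.
Proof.
move=> AU A0; suff /imsetP[x _ ->] : A \in label @: setT by exists x.
suff -> : label @: setT = powerset U :\ set0 by rewrite in_setD1 powersetE A0.
apply/eqP; rewrite eqEcard; apply/andP; split.
  apply/subsetP => _ /imsetP[x _ ->].
  by rewrite in_setD1 powersetE label_neq0 label_sub.
rewrite card_imset ?cardsT; last exact: label_inj.
have := cardsD1 set0 (powerset U).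
by rewrite powersetE sub0set card_powerset cardT /= add1n => ->; rewrite subn1.
Qed.

(** The isomorphism f is, on labels, the involution [tau]: add the rest of the
    neighbourhood of w to the sets that contain u.  It is the linear map that
    exchanges u and w, and fixes the other elements of U. *)
Lemma elc_iso u w : u \in U -> w \notin U -> e u w -> isomorphic (elc e u w) e.
Proof.
move=> uU wU euw; have [es ei] := simple_e; have [eU eW _ _] := h_e.
have ewu : e w u by rewrite es.
pose tau (A : {set T}) :=
  [set x | (x \in A) (+) [&& u \in A, x != u & x \in nbh e w]].
have tauK : involutive tau.
  move=> A; apply/setP => x; rewrite !inE eqxx andbF addbF.
  by case: (x \in A) (u \in A) (x != u) (e w x) => [] [] [] [].
have wE : label w = nbh e w by rewrite /label (negPf wU).
have tau_label x : exists y, label y == tau (label x).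
  suff [y <-] : exists y, label y = tau (label x) by exists y.
  apply: label_onto.
    apply/subsetP => y; rewrite inE; have [yx _|_] := boolP (y \in label x).
      exact: (subsetP (label_sub x)).
    by case/and3P => _ _; rewrite -wE; apply/subsetP/label_sub.
  apply: contra (label_neq0 x) => /eqP x0; rewrite -(tauK (label x)) x0.
  by apply/eqP/setP => y; rewrite !inE.
pose f x := xchoose (tau_label x).
have fE x : label (f x) = tau (label x) by apply/eqP/(xchooseP (tau_label x)).
have fK : involutive f by move=> x; apply: label_inj; rewrite !fE tauK.
have fw : f w = u.
  apply: label_inj; rewrite fE wE /label uU; apply/setP => x.
  rewrite !inE ewu /=; have [->|_] := eqVneq x u; first by rewrite ewu.
  by rewrite addbb.
have fU x : x \in U -> x != u -> f x = x.
  move=> xU xu; apply: label_inj; rewrite fE /label xU; apply/setP => y.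
  by rewrite !inE (eq_sym u) (negPf xu) addbF.
have fu : f u = w by rewrite -fw fK.
have uw : u != w by apply: contraNneq wU => <-.
pose s := tperm u w.
(* f maps the vertices of the new side U - u + w, which are those that tperm u w
   sends into U, onto U. *)
have fUE x : (f x \in U) = (s x \in U).
  rewrite /s; case: tpermP => [->|->|/eqP xu /eqP xw]; rewrite ?fu ?fw //.
  apply/idP/idP => [fxU|xU]; last by rewrite fU.
  have fxu : f x != u by apply: contra xw => /eqP fx; rewrite -(fK x) fx fu.
  by rewrite -[x]fK fU.
exists f; first by exists f.
have elc_sym x y : elc e u w x y = elc e u w y x.
  rewrite !elc_tperm // es (eq_sym x y) addbC.
  rewrite [RHS]addbC; congr addb.
  by case: (y != x) (x \in _) (y \in _) => [] [] [] //=;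
    rewrite addbC andbC [X in _ (+) X]andbC.
have main x y : s x \in U -> s y \notin U -> e (f x) (f y) = elc e u w x y.
  move=> sxU syU; rewrite adj_label ?fUE // fE.
  have xy : x != y by apply: contraNneq syU => <-.
  rewrite elc_tperm // -/s xy !inE /=; move: sxU syU; rewrite /s.
  case: tpermP => [->|->|/eqP xu /eqP xw] sxU; first by rewrite sxU in wU.
    rewrite fw !eqxx orbT andbF !addbF.
    case: tpermP => [->|->|/eqP yu /eqP yw] syU; last by rewrite adj_label.
      by rewrite /label uU !inE eqxx euw.
    by rewrite uU in syU.
  rewrite fU // (negPf xu) (negPf xw) /= (negPf (eU u x _ _)) //=.
  case: tpermP => [->|->|/eqP yu /eqP yw] syU.
  - by rewrite eqxx ei !andbF addbF /label uU !inE eqxx (negPf xu) (es x w).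
  - by rewrite uU in syU.
  - by rewrite (negPf yu) (negPf yw) !(adj_label _ syU) andbC.
(* Apart from u and w, two vertices on the same new side are on the same old
   side, so each product below contains an edge inside one side. *)
have toggle0 x y : (s x \in U) = (s y \in U) ->
    [&& x != y, x \notin [set u; w], y \notin [set u; w] &
        (e u x && e w y) (+) (e w x && e u y)] = false.
  rewrite !inE /s; case: tpermP => [->|->|_ _]; rewrite ?eqxx ?orbT ?andbF //.
  case: tpermP => [->|->|_ _]; rewrite ?eqxx ?orbT ?andbF //.
  have [xU /esym yU|xU /esym/negbT yU] := boolP (x \in U).
    by rewrite (negPf (eU u x _ _)) // (negPf (eU u y _ _)) // !andbF.
  by rewrite (negPf (eW w x _ _)) ?inE // (negPf (eW w y _ _)) ?inE // !andbF.
move=> x y; have := fUE x; have := fUE y.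
have [sxU|sxU] := boolP (s x \in U); have [syU|syU] := boolP (s y \in U).
- move=> fyU fxU; rewrite elc_tperm // toggle0 ?sxU ?syU // addbF -/s.
  by rewrite (negPf (eU _ _ fxU fyU)) (negPf (eU _ _ sxU syU)).
- by move=> _ _; apply: main.
- by move=> _ _; rewrite es elc_sym main.
- move=> /negbT fyU /negbT fxU.
  rewrite elc_tperm // toggle0 ?(negPf sxU) ?(negPf syU) // addbF -/s.
  by rewrite (negPf (eW _ _ _ _)) ?(negPf (eW _ _ _ _)) ?inE.
Qed.

End Labels.

Lemma h_structure_of_is_h r (T : finType) (e : rel T) :
  is_h r e -> exists2 U : {set T}, h_structure e U & #|U| = r.
Proof.
case=> _ _ [U [W [Wi [[UW disUW eU eW] cU _ WE [_ _ Wdeg Winj]]]]].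
have WC : W = ~: U.
  apply/setP => x; have := in_setT x; rewrite -UW !inE.
  by have [xU _|] //= := boolP (x \in U); rewrite (disjointFr disUW).
exists U => //; split=> //; rewrite -WC //.
  move=> a; rewrite {1}WE big_geq_mkord => /bigcupP[i /= i2 ai].
  have ir : 2 <= i <= r by rewrite i2 -ltnS ltn_ord.
  rewrite (leq_trans i2) // -[X in X <= _](Wdeg _ _ ir ai).
  exact: subset_leq_card (subsetIl _ _).
move=> a b aW bW ab; apply/eqP; rewrite -[_ == _]negbK.
by apply/negP => /(Winj _ _ aW bW); rewrite ab eqxx.
Qed.

(** The edge may be given from either end, and [elcC] exchanges the ends. *)
Lemma elc_preserved_h (T : finType) (e : rel T) (U : {set T}) :
  simple_graph e -> h_structure e U -> #|T| = 2 ^ #|U| - 1 -> elc_preserved e.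
Proof.
move=> simple_e h_e cardT u v euv; have [es _] := simple_e; have [eU eW _ _] := h_e.
have [uU|uU] := boolP (u \in U).
  apply: (@elc_iso _ _ U) => //.
  by apply: contraTN euv => vU; apply: eU.
have vU : v \in U by apply: contraTT euv => vU; apply: eW; rewrite inE.
have evu : e v u by rewrite es.
have [f bij_f f_mono] := elc_iso simple_e h_e cardT vU uU evu.
by exists f => // x y; rewrite (elcC simple_e euv).
Qed.

(** * Binary linear codes *)

Section BinaryCodes.

Local Open Scope ring_scope.

Lemma F2_neq0 (a : 'F_2) : a != 0 -> a = 1.
Proof. by case: a => [[|[|?]]] // ? _; apply: val_inj. Qed.

Lemma addF2 (V : lmodType 'F_2) (v : V) : v + v = 0.
Proof.
by rewrite -[v]scale1r -scalerDl (_ : 1 + 1 = 0 :> 'F_2) ?scale0r //; apply: val_inj.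
Qed.

Lemma oppF2 (V : lmodType 'F_2) (v : V) : - v = v.
Proof. by apply/eqP; rewrite eq_sym -subr_eq0 opprK addF2. Qed.

(** Codewords become dependencies among columns: over F_2 the only nonzero
    coefficient is 1, so a word is a codeword iff the columns on its support
    sum to zero. *)
Lemma mulmx_tr_support m n (H : 'M['F_2]_(m, n)) (x : 'rV_n) :
  H *m x^T = \sum_(i in [set i | x ord0 i != 0]) col i H.
Proof.
apply/colP => j; rewrite summxE mxE [RHS]big_mkcond; apply: eq_bigr => i _.
rewrite !mxE inE; case: eqP => [->|/eqP /F2_neq0 ->]; first by rewrite mulr0.
by rewrite mulr1.
Qed.

Lemma systematic_free k m (P : 'M['F_2]_(k, m)) :
  free [tuple row i (row_mx 1%:M P) | i < k].
Proof.
apply/freeP => c; under eq_bigr => i _ do rewrite -tnth_nth tnth_mktuple.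
pose a := \row_i c i.
rewrite (eq_bigr (fun i => a 0 i *: row i (row_mx 1%:M P))) => [|i _];
  last by rewrite mxE.
rewrite -mulmx_sum_row mul_mx_row mulmx1 => /(congr1 lsubmx).
by rewrite row_mxKl linear0 => /rowP a0 i; have := a0 i; rewrite !mxE.
Qed.

(** A word (a | b) is in the row space of (I | P) iff b = a P, which in
    characteristic 2 reads P^T a^T + b^T = 0. *)
Lemma mem_systematic k m (P : 'M['F_2]_(k, m)) x :
  (x \in <<[tuple row i (row_mx 1%:M P) | i < k]>>%VS) =
  (row_mx P^T 1%:M *m x^T == 0).
Proof.
set X := mktuple _.
have -> : (row_mx P^T 1%:M *m x^T == 0) = (lsubmx x *m P == rsubmx x).
  rewrite -{1}[x]hsubmxK tr_row_mx mul_row_col mul1mx -trmx_mul -linearD.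
  by rewrite -(inj_eq trmx_inj) trmxK trmx0 -[X in _ + X]oppF2 subr_eq0.
have spanE (a : 'rV_k) : \sum_i a 0 i *: X`_i = row_mx a (a *m P).
  under eq_bigr => i _ do rewrite -tnth_nth tnth_mktuple.
  by rewrite -mulmx_sum_row mul_mx_row mulmx1.
apply/idP/eqP => [/coord_span xE|xE].
  have := spanE (\row_i coord X i x).
  under eq_bigr => i _ do rewrite mxE.
  by rewrite -xE => ->; rewrite row_mxKl row_mxKr.
rewrite -[x]hsubmxK -xE -spanE rpred_sum // => i _; rewrite rpredZ //.
by rewrite memv_span // mem_nth // size_tuple.
Qed.

(** The n columns of H' are distinct and occur among the n columns of H, so they
    exhaust them. *)
Lemma perm_to_columns r n (H H' : 'M['F_2]_(r, n)) :
  injective (fun j => col j H') ->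
  (forall j, exists i, col i H = col j H') ->
  exists s : 'S_n, forall j, col (s j) H' = col j H.
Proof.
move=> inj' onto.
have onto2 j : exists i, col i H == col j H' by have [i /eqP] := onto j; exists i.
pose g j := xchoose (onto2 j).
have gE j : col (g j) H = col j H' by apply/eqP/(xchooseP (onto2 j)).
have g_inj : injective g by move=> i j gij; apply: inj'; rewrite -!gE gij.
exists (perm g_inj)^-1%g => j.
by rewrite -gE -[in RHS](permKV (perm g_inj) j) permE.
Qed.

Lemma code_equiv_of_columns r n (H H' : 'M['F_2]_(r, n)) (C C' : code n) (s : 'S_n) :
  (forall j, col (s j) H' = col j H) ->
  (forall x, (x \in C) = (H *m x^T == 0)) ->
  (forall x, (x \in C') = (H' *m x^T == 0)) ->
  code_equiv C C'.
Proof.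
move=> sE CE C'E; exists s => x; rewrite CE C'E; congr (_ == _).
rewrite !mulmx_tr_support [LHS](reindex_inj (@perm_inj _ s)) /=.
by apply: eq_big => [j|j _]; rewrite ?sE // !inE mxE.
Qed.

(** Permuting coordinates is an injective linear map, and it carries C' onto C. *)
Lemma code_equiv_dim n (C C' : code n) : code_equiv C C' -> \dim C = \dim C'.
Proof.
case=> s CC'; pose f : 'Hom('rV['F_2]_n, 'rV['F_2]_n) := linfun (col_perm s).
have fE x : f x = col_perm s x by rewrite lfunE.
have col_permVK x : col_perm s (col_perm s^-1%g x) = x :> 'rV['F_2]_n.
  by rewrite -col_permM mulgV col_perm1.
have <- : (f @: C')%VS = C.
  apply/vspaceP => x; apply/memv_imgP/idP => [[y + ->]|xC].
    by rewrite CC' fE.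
  by exists (col_perm s^-1%g x); rewrite ?fE ?CC' col_permVK.
apply: limg_dim_eq; apply/eqP; rewrite -subv0; apply/subvP => x.
rewrite memv_cap memv_ker fE memv0 => /andP[_ /eqP x0].
by rewrite -[x](col_perm1) -(mulVg s) col_permM x0 linear0.
Qed.

Lemma hdistE n (x y : 'rV['F_2]_n) :
  hdist x y = #|[set i | (x - y) ord0 i != 0]|.
Proof. by apply: eq_card => i; rewrite !inE !mxE subr_eq0. Qed.

Section ParityCheckDistance.

Variables (r n : nat) (H : 'M['F_2]_(r, n)) (C : code n).
Hypothesis CE : forall x, (x \in C) = (H *m x^T == 0).

(** A codeword of weight 1 is a zero column, and one of weight 2 a pair of equal
    columns; a dependent triple of columns is a codeword of weight 3. *)
Lemma parity_check_min_distance3 :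
  (forall j, col j H != 0) -> injective (fun j => col j H) ->
  (exists i j k, [/\ i != j, i != k, j != k & col i H + col j H + col k H = 0]) ->
  min_distance C 3.
Proof.
move=> H0 Hinj [i [j [k [ij ik jk Hijk]]]]; split.
  pose S := i |: [set j; k].
  have iS : i \notin [set j; k] by rewrite !inE negb_or ij.
  pose x : 'rV['F_2]_n := \row_l (l \in S)%:R.
  have suppx : [set l | x ord0 l != 0] = S.
    by apply/setP => l; rewrite inE mxE; case: (l \in S).
  have cS : #|S| = 3 by rewrite cardsU1 iS cards2 jk.
  exists x, 0; split.
  - rewrite CE mulmx_tr_support suppx big_setU1 //= big_setU1 ?inE //=.
    by rewrite big_set1 addrA Hijk.
  - exact: mem0v.
  - apply/eqP => x0; move: cS; rewrite -suppx x0.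
    rewrite (_ : [set _ | _] = set0) ?cards0 //.
    by apply/setP => l; rewrite !inE mxE eqxx.
  - by rewrite hdistE subr0 suppx.
move=> x y xC yC xy; rewrite hdistE.
have : x - y \in C by rewrite rpredB.
have : x - y != 0 by rewrite subr_eq0.
move: (x - y) => z z0; rewrite CE mulmx_tr_support.
set S := [set _ | _].
have : (0 < #|S|)%N.
  rewrite card_gt0; apply: contra z0 => /eqP S0; apply/eqP/rowP => l.
  have := in_set0 l; rewrite -S0 inE mxE => /negbT.
  by rewrite negbK => /eqP.
case cS : #|S| => [|[|[|]]] // _.
  have /cards1P[a ->] : #|S| == 1 by rewrite cS.
  by rewrite big_set1 (negPf (H0 a)).
have /cards2P[a [b [ab ->]]] : #|S| == 2 by rewrite cS.
rewrite big_setU1 ?inE //= big_set1 -[col b H]oppF2 subr_eq0.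
by move=> /eqP /Hinj abE; rewrite abE eqxx in ab.
Qed.

End ParityCheckDistance.

End BinaryCodes.

(** * The Hamming code and its graph *)

Section HammingColumns.

Local Open Scope ring_scope.

Variables (r n : nat) (H : 'M['F_2]_(r, n)).
Hypothesis HE : perm_eq (codom (fun j => col j H))
                  (enum [pred x : 'cV['F_2]_r | x != 0]).

Lemma hamming_col_inj : injective (fun j => col j H).
Proof.
by apply/injectiveP; rewrite /injectiveb /dinjectiveb (perm_uniq HE) enum_uniq.
Qed.

Lemma hamming_col_onto (v : 'cV_r) : v != 0 -> exists j, col j H = v.
Proof.
move=> v0; have : v \in codom (fun j => col j H) by rewrite (perm_mem HE) mem_enum.
by case/codomP => j ->; exists j.
Qed.

Lemma hamming_col_neq0 j : col j H != 0.
Proof.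
have : col j H \in codom (fun j => col j H) by apply: codom_f.
by rewrite (perm_mem HE) mem_enum.
Qed.

(** Two unit vectors and their sum; hence the bound on r. *)
Lemma hamming_dependent_triple : (1 < r)%N ->
  exists i j k, [/\ i != j, i != k, j != k & col i H + col j H + col k H = 0].
Proof.
move=> r1; pose a : 'cV['F_2]_r := delta_mx (Ordinal (ltnW r1)) 0.
pose b : 'cV['F_2]_r := delta_mx (Ordinal r1) 0.
have a0 : a != 0.
  by apply/eqP => /colP/(_ (Ordinal (ltnW r1))); rewrite !mxE !eqxx.
have b0 : b != 0 by apply/eqP => /colP/(_ (Ordinal r1)); rewrite !mxE !eqxx.
have ab : a != b.
  by apply/eqP => /colP/(_ (Ordinal r1)); rewrite !mxE !eqxx.
have ab0 : a + b != 0 by rewrite -[b]oppF2 subr_eq0.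
have [i iE] := hamming_col_onto a0; have [j jE] := hamming_col_onto b0.
have [k kE] := hamming_col_onto ab0.
exists i, j, k; split; last by rewrite iE jE kE addF2.
- by apply: contraNneq ab => ij; rewrite -iE -jE ij.
- apply: contraNneq b0 => ik; rewrite -(inj_eq (addrI a)) addr0.
  by rewrite -kE -ik iE.
- apply: contraNneq a0 => jk; rewrite -(inj_eq (addIr b)) add0r.
  by rewrite -kE -jk jE.
Qed.

End HammingColumns.

Section GraphOfHammingCode.

Local Open Scope ring_scope.

Variables (T : finType) (e : rel T) (U : {set T}).
Hypotheses (simple_e : simple_graph e) (h_e : h_structure e U).

(** The complement of U comes first, matching the block order of (I | P). *)
Definition vertex_at (a : 'I_(#|~: U| + #|U|)) : T :=
  match split a with inl i => enum_val i | inr j => enum_val j end.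

Lemma vertex_atL i : vertex_at (lshift _ i) = enum_val i.
Proof. by rewrite /vertex_at (unsplitK (inl i)). Qed.

Lemma vertex_atR j : vertex_at (rshift _ j) = enum_val j.
Proof. by rewrite /vertex_at (unsplitK (inr j)). Qed.

Lemma vertex_at_bij : bijective vertex_at.
Proof.
apply: inj_card_bij; last by rewrite card_ord addnC cardsC.
have mixed i j : vertex_at (lshift _ i) != vertex_at (rshift _ j).
  rewrite vertex_atL vertex_atR; have := enum_valP i; rewrite inE.
  by apply: contraNneq => ->; apply: enum_valP.
move=> a b; case: (split_ordP a) => i ->; case: (split_ordP b) => j -> ab.
- by move: ab; rewrite !vertex_atL => /enum_val_inj ->.
- by have := mixed i j; rewrite ab eqxx.
- by have := mixed j i; rewrite ab eqxx.
- by move: ab; rewrite !vertex_atR => /enum_val_inj ->.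
Qed.

Definition biadjmx : 'M['F_2]_(#|~: U|, #|U|) :=
  \matrix_(i, j) (e (enum_val i) (enum_val j))%:R.

Lemma biadjmx_isomorphic :
  isomorphic e (graph_of_adjmx (block_mx 0 biadjmx biadjmx^T 0)).
Proof.
have [eU eW _ _] := h_e; have [es _] := simple_e.
have nat_eq1 (b : bool) : (b%:R == 1 :> 'F_2) = b by case: b.
have [g gK Kg] := vertex_at_bij; exists g; first by exists vertex_at.
move=> x y; rewrite -{2}[x]Kg -{2}[y]Kg /graph_of_adjmx.
case: (split_ordP (g x)) => i ->; case: (split_ordP (g y)) => j ->.
- rewrite block_mxEul mxE !vertex_atL (negPf (eW _ _ _ _)) //; exact: enum_valP.
- by rewrite block_mxEur mxE nat_eq1 vertex_atL vertex_atR.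
- by rewrite block_mxEdl !mxE nat_eq1 vertex_atL vertex_atR es.
- rewrite block_mxEdr mxE !vertex_atR (negPf (eU _ _ _ _)) //; exact: enum_valP.
Qed.

(** The bridge between the two descriptions of the vertices: a column of
    (P^T | I) is the indicator vector of the label of its vertex. *)
Lemma parity_check_label i a :
  row_mx biadjmx^T 1%:M i a = (enum_val i \in label e U (vertex_at a))%:R.
Proof.
case: (split_ordP a) => j ->.
  rewrite row_mxEl !mxE vertex_atL -adj_label ?enum_valP //.
    by have [es _] := simple_e; rewrite es.
  by have := enum_valP j; rewrite inE.
rewrite row_mxEr mxE vertex_atR /label enum_valP inE.
by rewrite (inj_eq enum_val_inj).
Qed.

Lemma parity_check_col_inj :
  injective (fun a => col a (row_mx biadjmx^T 1%:M)).
Proof.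
move=> a b /colP ab; apply: (bij_inj vertex_at_bij).
apply: (label_inj h_e); apply/setP => x.
have [xU|xU] := boolP (x \in U); last first.
  by rewrite !(negPf (contra (subsetP (label_sub h_e _) x) xU)).
have := ab (enum_rank_in xU x); rewrite [LHS]mxE [RHS]mxE !parity_check_label.
rewrite enum_rankK_in //.
by do 2!case: (x \in _).
Qed.

Lemma parity_check_col_neq0 a : col a (row_mx biadjmx^T 1%:M) != 0.
Proof.
have /set0Pn[x xa] := label_neq0 h_e (vertex_at a).
have xU : x \in U := subsetP (label_sub h_e _) x xa.
apply/eqP => /colP/(_ (enum_rank_in xU x)).
by rewrite [LHS]mxE [RHS]mxE parity_check_label enum_rankK_in // xa.
Qed.

(** The columns of (P^T | I) are nonzero and distinct, hence they are the columns
    of H in another order.  The length is a variable n so that the equation for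
    n can be eliminated and the cast in [corresponds] is the identity. *)
Lemma corresponds_hamming n (nE : (#|~: U| + #|U|)%N = n) (C : code n)
    (H : 'M['F_2]_(#|U|, n)) :
  perm_eq (codom (fun j => col j H)) (enum [pred x : 'cV['F_2]_#|U| | x != 0]) ->
  (forall x, (x \in C) = (H *m x^T == 0)) ->
  \dim C = #|~: U| /\ corresponds e C.
Proof.
case: n / nE C H => C H HE CE.
pose M := row_mx 1%:M biadjmx.
pose C' := <<[tuple row i M | i < #|~: U|]>>%VS.
have [s sE] := perm_to_columns parity_check_col_inj
  (fun a => hamming_col_onto HE (parity_check_col_neq0 a)).
have CC' : code_equiv C C' by apply: code_equiv_of_columns sE CE (mem_systematic _).
have C'_basis : basis_of C' [tuple row i M | i < #|~: U|].
  by rewrite /basis_of eqxx systematic_free.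
split; first by rewrite (code_equiv_dim CC') (size_basis C'_basis).
exists #|~: U|, #|U|, erefl, biadjmx, C'; split=> //.
exact: biadjmx_isomorphic.
Qed.

End GraphOfHammingCode.

Theorem theorem5 (r : nat) (r_ge3 : 3 <= r) (T : finType) (e : rel T)
    (e_h : is_h r e) :
  elc_preserved e /\
  forall C : code (2 ^ r - 1), is_hamming r C ->
    code_params C (2 ^ r - r - 1) 3 /\ corresponds e C.
Proof.
have [simple_e cardT _] := e_h.
have [U h_e cU] := h_structure_of_is_h e_h; subst r.
split=> [|C [H [HE CE]]]; first exact: elc_preserved_h cardT.
have nE : (#|~: U| + #|U| = 2 ^ #|U| - 1)%N by rewrite addnC cardsC.
have [dimC eC] := corresponds_hamming simple_e h_e nE HE CE.
split=> //; split; first by rewrite dimC -subnDA addnC subnDA -nE addnK.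
apply: parity_check_min_distance3 CE _ _ _.
- exact: hamming_col_neq0.
- exact: hamming_col_inj.
- by apply: hamming_dependent_triple (ltnW r_ge3).
Qed.
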